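(* Let $(G,B,m,w)$ be a weighted finite graph with boundary such that each connected component of $G$ contains some interior vertices. Then: (1) for $i=1,2,\dots,|\Omega|$ and $j=0,1,\dots,|\Omega|-i$, $$\lambda_i\le\nu_{i+j}+\lambda_{|\Omega|-j}(A_BL_B^{-1}A_\Omega),$$ with equality for a pair $i,j$ if and only if there is a nonzero function $u\in\mathbb{R}^\Omega$ such that $\Delta^Du=\lambda_iu$, $\Delta^Nu=\nu_{i+j}u$ and $A_BL_B^{-1}A_\Omega u=\lambda_{|\Omega|-j}(A_BL_B^{-1}A_\Omega)u$; (2) for $i=1,2,\dots,|\Omega|$ and $j=1,2,\dots,i$, $$\lambda_i\ge\nu_{i-j+1}+\lambda_j(A_BL_B^{-1}A_\Omega),$$ with equality for a pair $i,j$ if and only if there is a nonzero function $u\in\mathbb{R}^\Omega$ such that $\Delta^Du=\lambda_iu$, $\Delta^Nu=\nu_{i-j+1}u$ and $A_BL_B^{-1}A_\Omega u=\lambda_j(A_BL_B^{-1}A_\Omega)u$.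
   Context: A weighted finite graph $(G,m,w)$ is a finite simple graph $G$ with vertex set $V$ and edge set $E$, a vertex-measure $m:V\to(0,\infty)$ and an edge-weight $w:E\to(0,\infty)$; $w$ is extended to a symmetric function on $V\times V$ by $w_{xy}=0$ when $\{x,y\}\notin E$. A weighted finite graph with boundary $(G,B,m,w)$ is a weighted finite graph with a nonempty subset $B\subset V$ (the boundary); $\Omega=V\setminus B$ is the interior. $\mathbb{R}^S$ is the space of real functions on $S$, with inner product $\langle u,v\rangle_S=\sum_{x\in S}u(x)v(x)m_x$. Laplacian: $\Delta u(x)=\frac1{m_x}\sum_{y\in V}(u(x)-u(y))w_{xy}$ for $u\in\mathbb{R}^V$. Dirichlet Laplacian: for $u\in\mathbb{R}^\Omega$ let $E_0(u)\in\mathbb{R}^V$ be its extension by $0$ on $B$, and $\Delta^Du=(\Delta E_0(u))|_\Omega$, a nonnegative self-adjoint operator on $\mathbb{R}^\Omega$ with eigenvalues (Dirichlet eigenvalues), counted with multiplicity, $0\le\lambda_1\le\dots\le\lambda_{|\Omega|}$. Neumann Laplacian: for $u\in\mathbb{R}^\Omega$, let $N_0(u)\in\mathbb{R}^V$ be the function with $N_0(u)=u$ on $\Omega$ and $\Delta N_0(u)=0$ on $B$ (unique since each component contains interior vertices). Set $\Delta^N u=(\Delta N_0(u))|_\Omega$, a nonnegative self-adjoint operator on $\mathbb{R}^\Omega$ with eigenvalues (Neumann eigenvalues), counted with multiplicity, $0\le\nu_1\le\dots\le\nu_{|\Omega|}$. Weighted adjacency operators: $A_B:\mathbb{R}^B\to\mathbb{R}^\Omega$,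 $A_Bu(x)=\frac1{m_x}\sum_{y\in B}u(y)w_{xy}$ for $x\in\Omega$, and $A_\Omega:\mathbb{R}^\Omega\to\mathbb{R}^B$, $A_\Omega u(x)=\frac1{m_x}\sum_{y\in\Omega}u(y)w_{xy}$ for $x\in B$. $L_B:\mathbb{R}^B\to\mathbb{R}^B$ is the Dirichlet Laplacian with Dirichlet boundary value on $\Omega$: $L_Bf=(\Delta\tilde f)|_B$, where $\tilde f$ is the extension of $f$ by $0$ on $\Omega$; it is invertible because each component of $G$ contains interior vertices. $A_BL_B^{-1}A_\Omega$ is self-adjoint on $\mathbb{R}^\Omega$. For a self-adjoint operator $T$ on an $N$-dimensional space, $\lambda_1(T)\le\dots\le\lambda_N(T)$ are its eigenvalues counted with multiplicity (whereas $\lambda_i$ without argument is a Dirichlet eigenvalue). *)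

(* Defs.v *)
From HB Require Import structures.
From mathcomp Require Import all_boot all_order all_algebra.
From mathcomp Require Import polyrcf.
From mathcomp Require Import boolp classical_sets.

Set Implicit Arguments.
Unset Strict Implicit.
Unset Printing Implicit Defensive.

Import Order.TTheory GRing.Theory Num.Theory.
Local Open Scope ring_scope.

Record wgraph (R : rcfType) (V : finType) := WGraph {
  edge : rel V;
  mass : V -> R;
  weight : V -> V -> R;
  edge_sym : symmetric edge;
  edge_irr : irreflexive edge;
  mass_gt0 : forall x, 0 < mass x;
  weight_sym : forall x y, weight x y = weight y x;
  weight_gt0 : forall x y, edge x y -> 0 < weight x y;
  weight_eq0 : forall x y, ~~ edge x y -> weight x y = 0
}.

(* The codomain is the regular module R^o so that the function spaces inherit
   the vectType structure of {ffun I -> R^o}. *)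
Notation fspace R S := {ffun {x | x \in S} -> R^o}.

(* Roots of the characteristic polynomial in increasing order (rootsR is sorted
   and duplicate-free), each repeated according to its multiplicity. *)
Definition eigenvalues (R : rcfType) (U : vectType R) (T : 'End(U)) : seq R :=
  let p := char_poly (passmx.mxof (vbasis fullv) (vbasis fullv) T) in
  flatten [seq nseq (mup a p) a | a <- rootsR p].

(* The i-th smallest eigenvalue; i is counted from 1. *)
Definition eigenvalue_nth (R : rcfType) (U : vectType R) (T : 'End(U))
    (i : nat) : R := (eigenvalues T)`_i.-1.

Section Operators.
Variables (R : rcfType) (V : finType) (G : wgraph R V).
Implicit Types S B : {set V}.

Definition laplacian (u : {ffun V -> R^o}) : {ffun V -> R^o} :=
  [ffun x => (mass G x)^-1 * \sum_y (u x - u y) * weight G x y].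

Definition ext0 S (u : fspace R S) : {ffun V -> R^o} :=
  [ffun x => if insub x is Some y then u y else 0].

Definition restrict S (u : {ffun V -> R^o}) : fspace R S :=
  [ffun x => u (val x)].

(* The Dirichlet Laplacian on S with boundary ~: S: it is Delta^D for
   S = ~: B and L_B for S = B. *)
Definition dirichlet_laplacian S (u : fspace R S) : fspace R S :=
  restrict S (laplacian (ext0 u)).

(* The weighted adjacency operator R^S -> R^S': it is A_B for S = B,
   S' = ~: B, and A_Omega for S = ~: B, S' = B. *)
Definition adjacency S S' (u : fspace R S) : fspace R S' :=
  [ffun x => (mass G (val x))^-1 *
             \sum_(y : {y | y \in S}) u y * weight G (val x) (val y)].

Definition is_harmonic_ext B (u : fspace R (~: B)) (v : {ffun V -> R^o}) :=
  restrict (~: B) v = u /\ forall x, x \in B -> laplacian v x = 0.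

(* N_0(u): the v such that is_harmonic_ext u v; see harmonic_ext_exists and
   harmonic_ext_unique below. *)
Definition harmonic_ext B (u : fspace R (~: B)) : {ffun V -> R^o} :=
  xget 0 (@is_harmonic_ext B u).

Definition neumann_laplacian B (u : fspace R (~: B)) : fspace R (~: B) :=
  restrict (~: B) (laplacian (harmonic_ext u)).

Definition component_meets_interior B :=
  forall x, exists2 y, y \notin B & connect (edge G) x y.

(* linfun f agrees with f only when f is linear. dirichlet_laplacian and
   adjacency are linear unconditionally, neumann_laplacian is linear when every
   component meets the interior (neumann_laplacian_is_linear below). The lfun
   inverse of L_B is then a genuine inverse, by dirichlet_laplacian_inj. *)
Definition DirichletL B : 'End(fspace R (~: B)) :=
  linfun (@dirichlet_laplacian (~: B)).

Definition NeumannL B : 'End(fspace R (~: B)) := linfun (@neumann_laplacian B).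

Definition AdjLinvAdj B : 'End(fspace R (~: B)) :=
  (linfun (@adjacency B (~: B))
   \o (linfun (@dirichlet_laplacian B))^-1
   \o linfun (@adjacency (~: B) B))%VF.

Fact laplacian_is_linear : linear laplacian.
Proof.
move=> a u v; apply/ffunP => x; rewrite !ffunE /=.
rewrite /GRing.scale /= mulrCA -mulrDr; congr (_ * _).
rewrite mulr_sumr -big_split; apply: eq_bigr => y _ /=.
rewrite !ffunE /GRing.scale /= mulrA -mulrDl mulrBr opprD addrACA.
by [].
Qed.
HB.instance Definition _ :=
  GRing.isLinear.Build R {ffun V -> R^o} {ffun V -> R^o} _ laplacian
    laplacian_is_linear.

Fact ext0_is_linear S : linear (@ext0 S).
Proof.
move=> a u v; apply/ffunP => x; rewrite !ffunE /=.
by case: insubP => [y _ _|_]; rewrite ?ffunE // scaler0 addr0.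
Qed.
HB.instance Definition _ S :=
  GRing.isLinear.Build R (fspace R S) {ffun V -> R^o} _ (@ext0 S)
    (@ext0_is_linear S).

Fact restrict_is_linear S : linear (@restrict S).
Proof. by move=> a u v; apply/ffunP => x; rewrite !ffunE. Qed.
HB.instance Definition _ S :=
  GRing.isLinear.Build R {ffun V -> R^o} (fspace R S) _ (@restrict S)
    (@restrict_is_linear S).

Fact dirichlet_laplacian_is_linear S : linear (@dirichlet_laplacian S).
Proof. by move=> a u v; rewrite /dirichlet_laplacian !linearP. Qed.
HB.instance Definition _ S :=
  GRing.isLinear.Build R (fspace R S) (fspace R S) _ (@dirichlet_laplacian S)
    (@dirichlet_laplacian_is_linear S).

Fact adjacency_is_linear S S' : linear (@adjacency S S').
Proof.
move=> a u v; apply/ffunP => x; rewrite !ffunE /=.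
rewrite /GRing.scale /= mulrCA -mulrDr; congr (_ * _).
rewrite mulr_sumr -big_split; apply: eq_bigr => y _ /=.
by rewrite !ffunE /GRing.scale /= mulrDl mulrA.
Qed.
HB.instance Definition _ S S' :=
  GRing.isLinear.Build R (fspace R S) (fspace R S') _ (@adjacency S S')
    (@adjacency_is_linear S S').

Lemma weight_ge0 x y : 0 <= weight G x y.
Proof.
by have [/weight_gt0/ltW//|/weight_eq0->] := boolP (edge G x y).
Qed.

Lemma laplacian_energy (v : {ffun V -> R^o}) :
  (\sum_x mass G x * (v x * laplacian v x)) *+ 2 =
  \sum_x \sum_y (v x - v y) ^+ 2 * weight G x y.
Proof.
have E : \sum_x mass G x * (v x * laplacian v x) =
         \sum_x \sum_y v x * (v x - v y) * weight G x y.
  apply: eq_bigr => x _; rewrite ffunE mulrCA mulVKf ?gt_eqF ?mass_gt0 //.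
  by rewrite mulr_sumr; apply: eq_bigr => y _; rewrite mulrA.
rewrite E mulr2n [X in _ + X]exchange_big -big_split.
apply: eq_bigr => x _; rewrite -big_split; apply: eq_bigr => y _ /=.
rewrite (weight_sym G y x) -mulrDl expr2 [in RHS]mulrBl; congr (_ * _).
by rewrite -(opprB (v x) (v y)) mulrN.
Qed.

Section Uniqueness.
Variable B : {set V}.
Hypothesis BG : component_meets_interior B.

Lemma harmonic_vanish (v : {ffun V -> R^o}) :
  (forall x, x \notin B -> v x = 0) ->
  (forall x, x \in B -> laplacian v x = 0) -> v = 0.
Proof.
move=> v0 Lv0.
have sq0 x y : 0 <= (v x - v y) ^+ 2 * weight G x y.
  by rewrite mulr_ge0 ?sqr_ge0 ?weight_ge0.
have Ev : \sum_x \sum_y (v x - v y) ^+ 2 * weight G x y = 0.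
  rewrite -laplacian_energy big1 ?mul0rn // => x _.
  by have [/Lv0->|/v0->] := boolP (x \in B); rewrite ?mulr0 ?mul0r ?mulr0.
have vE x y : edge G x y -> v x = v y.
  move=> exy; move/eqP: Ev; rewrite psumr_eq0 => [|z _]; last exact: sumr_ge0.
  move=> /allP/(_ x (mem_index_enum _)); rewrite psumr_eq0 //.
  move=> /allP/(_ y (mem_index_enum _)).
  rewrite mulf_eq0 (gt_eqF (weight_gt0 exy)) orbF sqrf_eq0 subr_eq0.
  by move/eqP.
apply/ffunP => x; rewrite ffunE; have [y /v0 <- /connectP[p]] := BG x.
elim: p x => [|z p IH] x /=; first by move=> _ ->.
by case/andP=> /vE-> pzp yE; exact: IH.
Qed.

Lemma harmonic_ext_unique (u : fspace R (~: B)) v1 v2 :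
  is_harmonic_ext u v1 -> is_harmonic_ext u v2 -> v1 = v2.
Proof.
move=> [r1 h1] [r2 h2]; apply/eqP; rewrite -subr_eq0; apply/eqP.
apply: harmonic_vanish => x xB.
  have xO : x \in ~: B by rewrite inE.
  have /ffunP/(_ (exist _ x xO)) : restrict (~: B) v1 = restrict (~: B) v2.
    by rewrite r1 r2.
  by rewrite !ffunE /= => ->; rewrite subrr.
have /ffunP/(_ x) : laplacian (v1 - v2) = laplacian v1 - laplacian v2.
  exact: linearB.
by move=> ->; rewrite [LHS]ffunE [X in _ + X]ffunE h1 // h2 // subr0.
Qed.

Lemma harmonic_ext_exists (u : fspace R (~: B)) :
  exists v, is_harmonic_ext u v.
Proof.
pose F (v : {ffun V -> R^o}) : {ffun V -> R^o} :=
  [ffun x => if x \in B then laplacian v x else v x].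
have Flin : linear F.
  move=> a v w; apply/ffunP => x.
  rewrite [LHS]ffunE [RHS]ffunE [X in _ = X + _]ffunE.
  rewrite [F v x]ffunE [F w x]ffunE; case: ifP => _; last by rewrite !ffunE.
  by rewrite linearP [LHS]ffunE [X in X + _]ffunE.
pose FL := GRing.isLinear.Build R {ffun V -> R^o} {ffun V -> R^o} _ F Flin.
pose Fl : {linear {ffun V -> R^o} -> {ffun V -> R^o}} := HB.pack F FL.
have FlE v : linfun Fl v = F v by rewrite lfunE.
have inj : lker (linfun Fl) == 0%VS.
  apply/eqP/vspaceP => v; rewrite memv_ker memv0 FlE.
  apply/eqP/eqP => [/ffunP Fv|->]; last exact: (linear0 Fl).
  apply: harmonic_vanish => x xB.
    by have := Fv x; rewrite !ffunE (negPf xB).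
  by have := Fv x; rewrite 2![in LHS]ffunE xB !ffunE.
exists ((linfun Fl)^-1%VF (ext0 u)).
set v := (_ ^-1)%VF _.
have /ffunP vE : F v = ext0 u by rewrite -FlE lker0_lfunVK.
split=> [|x xB].
  apply/ffunP => x; have := vE (val x); rewrite !ffunE valK.
  by have := valP x; rewrite inE => /negPf ->.
have := vE x; rewrite [LHS]ffunE [RHS]ffunE xB => ->.
by rewrite insubN ?inE ?xB.
Qed.

Lemma harmonic_extP (u : fspace R (~: B)) : is_harmonic_ext u (harmonic_ext u).
Proof. exact: xgetPex (harmonic_ext_exists u). Qed.

Lemma neumann_laplacian_is_linear : linear (@neumann_laplacian B).
Proof.
move=> a u v; rewrite /neumann_laplacian -!linearP.
congr (restrict _ (laplacian _)).
apply: harmonic_ext_unique (harmonic_extP _) _.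
have [[ru hu] [rv hv]] := (harmonic_extP u, harmonic_extP v).
split=> [|x xB].
  by rewrite restrict_is_linear ru rv.
have /ffunP/(_ x) : laplacian (a *: harmonic_ext u + harmonic_ext v) =
    a *: laplacian (harmonic_ext u) + laplacian (harmonic_ext v).
  exact: linearP.
by move=> ->; rewrite [LHS]ffunE [X in X + _]ffunE hu // hv // scaler0 addr0.
Qed.

Lemma dirichlet_laplacian_inj : injective (@dirichlet_laplacian B).
Proof.
move=> f g fg; apply/eqP; rewrite -subr_eq0; apply/eqP.
have : ext0 (f - g) = 0.
  apply: harmonic_vanish => x xB; first by rewrite ffunE insubN.
  have /ffunP/(_ (exist _ x xB)) : dirichlet_laplacian (f - g) = 0.
    by rewrite linearB /= fg subrr.
  by rewrite ffunE [in RHS]ffunE.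
move=> /ffunP e0; apply/ffunP => x.
by have := e0 (val x); rewrite ffunE valK => ->; rewrite !ffunE.
Qed.

End Uniqueness.
End Operators.

(* Main.v *)
(* The harmonic extension of u is E_0(u) plus the extension by 0 of
   L_B^-1 A_Omega u, whence Delta^D = Delta^N + A_B L_B^-1 A_Omega, a sum of
   two operators which are self-adjoint for the inner product weighted by m.
   The inequalities are then Weyl's: for T = T1 + T2, a spectral subspace of
   each of T, T1, T2, spanned by eigenvectors with eigenvalues on one side of
   the prescribed one, can be chosen so that the dimensions add up to 2n + 1.
   The three subspaces thus share a nonzero u, and comparing the Rayleigh
   quotients of u gives the inequality; in the equality case each of the three
   Rayleigh bounds is attained at u, so u is a common eigenvector. *)
From HB Require Import structures.
From mathcomp Require Import polyrcf complex zify ring lra.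
Require Import Defs.
From mathcomp Require Import all_boot all_order all_algebra.
Import Order.TTheory GRing.Theory Num.Theory passmx.
Local Open Scope ring_scope.
Set Implicit Arguments.
Unset Strict Implicit.
Unset Printing Implicit Defensive.

(** * Eigenvalues as roots of the characteristic polynomial *)

Section Eigenvalues.
Variables (R : rcfType) (U : vectType R).
Implicit Types (T : 'End(U)) (b s : seq U).

(** Since [R[i]] is algebraically closed, the matrix of [T] has an eigenvector over it, with
    eigenvalue [a + i c]; [x] and [y] are the real and imaginary parts of that eigenvector. *)
Lemma complex_eigenvector T : (0 < \dim {:U})%N ->
  exists a c : R, exists x y : U, [/\ (x != 0) || (y != 0),
    T x = a *: x - c *: y & T y = c *: x + a *: y].
Proof.
move=> U_gt0; pose e := vbasis {:U}; have eb : basis_of {:U} e := vbasisP _.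
pose M := mxof e e T.
pose A := map_mx (real_complex R) M.
have [z] : exists z, root (char_poly A) z.
  by apply/closed_rootP; rewrite size_char_poly eqSS -lt0n.
rewrite -eigenvalue_root_char => /eigenvalueP[v Av nz_v].
(* To be used for [f] the real or the imaginary part: these commute with multiplication by [M],
   whose entries are real. *)
have vM (f : {additive R[i] -> R}) : (forall x y, f (x * y%:C%C) = f x * y) ->
    map_mx f (z *: v) = map_mx f v *m M.
  move=> fM; rewrite -Av; apply/rowP => j; rewrite !mxE raddf_sum.
  by apply: eq_bigr => k _; rewrite !mxE fM.
pose x := vecof e (map_mx (@complex.Re R) v).
pose y := vecof e (map_mx (@complex.Im R) v).
exists (complex.Re z), (complex.Im z), x, y; split.
- rewrite /x /y !vecof_eq0 // -negb_and; apply: contraNN nz_v.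
  case/andP=> /eqP/rowP re0 /eqP/rowP im0; apply/eqP/rowP => j.
  by move: (re0 j) (im0 j); rewrite !mxE; case: (v 0 j) => p q /= -> ->.
- rewrite /x (hom_vecof _ eb) -(vM (@complex.Re R)); last first.
    by move=> [p q] r /=; rewrite mulr0 subr0.
  rewrite -!linearZ -linearB /=; congr vecof.
  apply/rowP => j; rewrite !mxE.
  by case: (z) (v 0 j) => p q [p' q'].
- rewrite /y (hom_vecof _ eb) -(vM (@complex.Im R)); last first.
    by move=> [p q] r /=; rewrite mulr0 add0r.
  rewrite -!linearZ -linearD /=; congr vecof.
  apply/rowP => j; rewrite !mxE.
  by case: (z) (v 0 j) => p q [p' q'] /=; rewrite addrC.
Qed.

(** The two matrices are conjugate by mutually inverse change-of-basis matrices. This frees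
    [eigenvalues] from the basis [vbasis] in its definition. *)
Lemma char_poly_mxof (e f : (\dim {:U}).-tuple U) T :
  basis_of {:U} e -> basis_of {:U} f ->
  char_poly (mxof e e T) = char_poly (mxof f f T).
Proof.
move=> eb fb; pose P := mxof e f \1%VF; pose Q := mxof f e \1%VF.
have PQ : P *m Q = 1%:M.
  by rewrite -mxof_comp // comp_lfun1l mxof1 // (basis_free eb).
have -> : mxof e e T = P *m mxof f f T *m Q.
  by rewrite -!mxof_comp // comp_lfun1l comp_lfun1r.
have PQX : map_mx polyC P *m map_mx polyC Q = 1%:M.
  by rewrite -map_mxM PQ map_mx1.
rewrite /char_poly /char_poly_mx !map_mxM.
rewrite -[X in \det (X - _) = _]mulmx1 -PQX mulmxA -scalar_mxC.
by rewrite -mulmxBl -mulmxBr !det_mulmx mulrAC -det_mulmx PQX det1 mul1r.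
Qed.

Lemma sorted_flatten_nseq (m : R -> nat) (s : seq R) :
  sorted <%R s -> sorted <=%R (flatten [seq nseq (m a) a | a <- s]).
Proof.
rewrite (sorted_pairwise lt_trans) (sorted_pairwise le_trans).
elim: s => //= a s IH /andP[lt_a /IH srt_s].
rewrite pairwise_cat srt_s andbT; apply/andP; split.
  apply/allrelP => x y /nseqP[-> _] /flatten_mapP[c cs /nseqP[-> _]].
  exact: ltW (allP lt_a c cs).
by elim: (m a) => //= k ->; rewrite andbT; apply/allP => x /nseqP[-> _].
Qed.

Lemma count_flatten_nseq (m : R -> nat) (s : seq R) x : uniq s ->
  count_mem x (flatten [seq nseq (m a) a | a <- s]) =
    if x \in s then m x else 0.
Proof.
elim: s => //= a s IH /andP[aNs /IH {}IH].
rewrite count_cat IH count_nseq in_cons /=.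
have [->|_] := eqVneq x a; last by rewrite mul0n.
by rewrite (negPf aNs) mul1n addn0.
Qed.

(** Both lists are sorted, and in both a value occurs as often as its multiplicity as a root of the
    polynomial. *)
Lemma eigenvalues_char_poly T (d : seq R) :
  char_poly (mxof (vbasis {:U}) (vbasis {:U}) T) =
    \prod_(a <- d) ('X - a%:P) ->
  eigenvalues T = sort <=%R d.
Proof.
rewrite /eigenvalues => ->; set p := \prod_(a <- d) _.
have p0 : p != 0 by rewrite monic_neq0 // monic_prod_XsubC.
have srt : sorted <%R (rootsR p) by exact: sorted_roots.
apply: (sorted_eq le_trans le_anti).
- exact: sorted_flatten_nseq.
- exact: sort_le_sorted.
rewrite perm_sym perm_sort; apply/allP => x _ /=; apply/eqP.
rewrite count_flatten_nseq ?(lt_sorted_uniq srt) // -mu_prod_XsubC -/p.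
by rewrite -(roots_on_rootsR p0) in_itv /=; case: ifPn => // /mupNroot.
Qed.

(** In a basis of eigenvectors the matrix is diagonal, so its characteristic polynomial splits over
    the values [ev v]. *)
Lemma eigenvalues_eigenbasis T b (ev : U -> R) :
  basis_of {:U} b -> {in b, forall v, T v = ev v *: v} ->
  eigenvalues T = sort <=%R (map ev b).
Proof.
move=> bb Tb; apply: eigenvalues_char_poly.
have sz : size b == \dim {:U}
  by rewrite -(eqnP (basis_free bb)) (span_basis bb).
pose f := Tuple sz; have fb : basis_of {:U} f by [].
rewrite (char_poly_mxof _ (vbasisP _) fb).
have fE i j : mxof f f T i j = ev f`_i * (i == j)%:R.
  rewrite !mxE /= vecof_delta Tb ?mem_nth ?(eqP sz) // linearZ /=.
  by rewrite coord_free ?(basis_free fb) // eq_sym.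
rewrite char_poly_trig; last first.
  by apply/is_trig_mxP => i j ij; rewrite fE -val_eqE ltn_eqF // mulr0.
rewrite big_map (big_nth 0) big_mkord (eqP sz); apply: eq_bigr => i _.
by rewrite fE eqxx mulr1.
Qed.
End Eigenvalues.

(** * Spectral theorem for self-adjoint operators *)

Section Spectral.
Variables (R : rcfType) (U : vectType R) (dot : U -> U -> R).
Hypothesis dot_linear : forall w, linear_for *%R (dot^~ w).
Hypothesis dotC : forall u v, dot u v = dot v u.
Hypothesis dot_gt0 : forall u, u != 0 -> 0 < dot u u.

Lemma dotDl u v w : dot (u + v) w = dot u w + dot v w.
Proof. by have := dot_linear w 1 u v; rewrite scale1r mul1r. Qed.

Lemma dot0l w : dot 0 w = 0.
Proof. by apply/(addrI (dot 0 w)); rewrite -dotDl !addr0. Qed.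

Lemma dotZl a v w : dot (a *: v) w = a * dot v w.
Proof. by rewrite -[a *: v]addr0 dot_linear dot0l addr0. Qed.

Lemma dotBl u v w : dot (u - v) w = dot u w - dot v w.
Proof. by rewrite dotDl -scaleN1r dotZl mulN1r. Qed.

Lemma dotZr a v w : dot v (a *: w) = a * dot v w.
Proof. by rewrite dotC dotZl dotC. Qed.

Lemma dotDr u v w : dot u (v + w) = dot u v + dot u w.
Proof. by rewrite dotC dotDl !(dotC u). Qed.

Lemma dot_suml I (r : seq I) (F : I -> U) w :
  dot (\sum_(i <- r) F i) w = \sum_(i <- r) dot (F i) w.
Proof. by apply: (big_morph (dot^~ w)) => [u v|]; rewrite ?dotDl ?dot0l. Qed.

Lemma dot_ge0 u : 0 <= dot u u.
Proof.
by have [->|/dot_gt0/ltW//] := eqVneq u 0; rewrite dot0l.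
Qed.

Lemma dot_eq0 u : (dot u u == 0) = (u == 0).
Proof.
by have [->|/dot_gt0/gt_eqF//] := eqVneq u 0; rewrite dot0l eqxx.
Qed.

Definition self_adjoint (T : 'End(U)) := forall u v, dot (T u) v = dot u (T v).

Definition pairwise_orthogonal (s : seq U) :=
  {in s &, forall v w, v != w -> dot v w = 0}.

Implicit Types (T : 'End(U)) (b s : seq U) (W : {vspace U}).

Lemma self_adjoint_eigenvector T W : self_adjoint T -> (T @: W <= W)%VS ->
  W != 0%VS -> exists a : R, exists2 v, v \in W & v != 0 /\ T v = a *: v.
Proof.
move=> Tsa TW W0.
(* The restriction of [T] to [W]; since [W] is invariant, the projection changes nothing. *)
pose T' : 'End(subvs_of W) := linfun (vsproj W \o T \o vsval).
have T'E x : vsval (T' x) = T (vsval x).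
  rewrite lfunE /= vsprojK //; apply: (subvP TW); apply: memv_img.
  exact: subvsP.
have [|a [c [x [y [xy0]]]]] := @complex_eigenvector _ _ T'.
  by rewrite dimvf /dim /= lt0n dimv_eq0.
move=> /(congr1 vsval) Tx /(congr1 vsval) Ty.
rewrite T'E linearB !linearZ /= scalerN in Tx.
rewrite T'E linearD !linearZ /= in Ty.
have x0 : (x == 0) = (vsval x == 0) by rewrite -(inj_eq val_inj) linear0.
have y0 : (y == 0) = (vsval y == 0) by rewrite -(inj_eq val_inj) linear0.
rewrite x0 y0 in xy0.
move: (vsval x) (vsval y) (subvsP x) (subvsP y) Tx Ty xy0 => {x0 y0 x y} x y.
move=> xW yW Tx Ty xy0.
(* Symmetry of T yields c (|x|^2 + |y|^2) = 0, so the eigenvalue a + i c is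
   real. *)
have c0 : c = 0.
  have := Tsa x y; rewrite Tx Ty dotBl !dotZl dotDr !dotZr => E.
  have /eqP : c * (dot x x + dot y y) = 0.
    by move: E; lra.
  rewrite mulf_eq0 => /orP[/eqP //|].
  rewrite paddr_eq0 ?dot_ge0 // !dot_eq0.
  by move=> /andP[x0 y0]; rewrite x0 y0 in xy0.
move: Tx Ty; rewrite c0 !scale0r subr0 add0r => Tx Ty.
by exists a; case/orP: xy0 => [x0|y0]; [exists x|exists y].
Qed.

(** On an eigenvector this is its eigenvalue, which thus becomes a function of the vector, as
    [eigenvalues_eigenbasis] requires. *)
Definition rayleigh T v := dot (T v) v / dot v v.

Lemma rayleigh_eigenvector T v a : v != 0 -> T v = a *: v ->
  T v = rayleigh T v *: v.
Proof. by move=> v0 Tv; rewrite /rayleigh Tv dotZl mulfK // dot_eq0. Qed.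

(** [H] is the kernel of the functional [dot v]. The image of [W] under it is a line, as it contains
    [dot v v], and rank-nullity gives the drop by one. *)
Lemma orthogonal_hyperplane v : v != 0 ->
  exists2 H : {vspace U}, forall u, (u \in H) = (dot v u == 0)
    & forall W, v \in W -> \dim W = (\dim (W :&: H)).+1.
Proof.
move=> v0; have lin : linear (dot v : U -> R^o).
  by move=> a u w; rewrite dotDr dotZr.
pose L := GRing.isLinear.Build R U R^o _ (dot v : U -> R^o) lin.
pose phi : {linear U -> R^o} := HB.pack (dot v : U -> R^o) L.
have phiE u : linfun phi u = dot v u by rewrite lfunE.
exists (lker (linfun phi)) => [u|W vW]; first by rewrite memv_ker phiE.
rewrite -(limg_ker_dim (linfun phi) W) -addn1; congr (_ + _)%N.
apply/eqP; rewrite eqn_leq; apply/andP; split.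
  by apply: leq_trans (dimvS (subvf _)) _; rewrite dimvf.
rewrite lt0n dimv_eq0; apply: contraTneq (memv_img (linfun phi) vW) => ->.
by rewrite memv0 phiE dot_eq0.
Qed.

(** Induction on the dimension: an eigenvector is split off, and its orthogonal complement in [W] is
    again invariant because [T] is self-adjoint. *)
Lemma orthogonal_eigenvectors T W : self_adjoint T -> (T @: W <= W)%VS ->
  exists b, [/\ basis_of W b, pairwise_orthogonal b
    & {in b, forall v, T v = rayleigh T v *: v}].
Proof.
move=> Tsa; move dW: (\dim W) => n.
elim: n W dW => [|n IH] W dW TW.
  by exists [::]; split=> //; rewrite basisEfree nil_free dW span_nil sub0v.
have W0 : W != 0%VS by rewrite -dimv_eq0 dW.
have [a [v vW [v0 Tv]]] := self_adjoint_eigenvector Tsa TW W0.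
have [H HE dH] := orthogonal_hyperplane v0.
have [||b [bb bO bT]] := IH (W :&: H)%VS.
- by apply: succn_inj; rewrite -dH.
- apply/subvP => _ /memv_imgP[w + ->]; rewrite !memv_cap !HE.
  move=> /andP[wW /eqP vw]; rewrite (subvP TW) ?memv_img //=.
  by rewrite -Tsa Tv dotZl vw mulr0.
have bH w : w \in b -> dot v w = 0.
  by move=> /(basis_mem bb); rewrite memv_cap HE => /andP[_ /eqP].
exists (v :: b); split.
(* [v] is not orthogonal to itself, hence lies outside the span of [b]; that the longer list spans
   [W] follows by counting dimensions. *)
- rewrite basisEfree free_cons (basis_free bb) (span_basis bb) memv_cap HE.
  rewrite dot_eq0 (negPf v0) andbF /= span_cons (span_basis bb) subv_add.
  rewrite -memvE vW capvSl /= dH // ltnS.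
  by rewrite -(eqnP (basis_free bb)) (span_basis bb).
- move=> x y; rewrite !inE.
  move=> /predU1P[->|xb] /predU1P[->|yb]; rewrite ?eqxx //; last exact: bO.
    by rewrite bH.
  by rewrite dotC bH.
- move=> x; rewrite inE => /predU1P[->|/bT //].
  exact: rayleigh_eigenvector Tv.
Qed.

Lemma spectral_basis T : self_adjoint T ->
  exists b, [/\ basis_of {:U} b, pairwise_orthogonal b,
    {in b, forall v, T v = rayleigh T v *: v}
    & eigenvalues T = map (rayleigh T) b].
Proof.
move=> Tsa; have [b [bb bO bT]] := orthogonal_eigenvectors Tsa (subvf _).
(* Sorting the basis by eigenvalue aligns positions in it with the indices of [eigenvalues T]. *)
pose r := relpre (rayleigh T) <=%R.
exists (sort r b); split.
- by rewrite (perm_basis _ (_ : perm_eq _ b)) ?perm_sort.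
- by move=> x y; rewrite !mem_sort; exact: bO.
- by move=> x; rewrite mem_sort; exact: bT.
- by rewrite (eigenvalues_eigenbasis bb bT) sort_map.
Qed.

(** In the orthogonal family [s] the defect [c * dot u u - dot (T u) u] is a sum of nonnegative
    terms [k i ^+ 2 * (c - ev s_i) * |s_i|^2]. If it vanishes, so does each [k i * (c - ev s_i)],
    and these are the coefficients of [c *: u - T u]. *)
Lemma rayleigh_span_le T s (ev : U -> R) c u :
  free s -> pairwise_orthogonal s ->
  {in s, forall v, T v = ev v *: v} -> {in s, forall v, ev v <= c} ->
  u \in <<s>>%VS -> dot (T u) u <= c * dot u u ?= iff (T u == c *: u).
Proof.
move=> fs sO sT sc us.
have [k uE] : exists k : 'I_(size s) -> R, u = \sum_i k i *: s`_i.
  exists (fun i => coord (in_tuple s) i u).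
  exact: (@coord_span _ _ _ (in_tuple s)).
have sI (i : 'I_(size s)) : s`_i \in s by rewrite mem_nth.
have si_u (i : 'I_(size s)) : dot s`_i u = k i * dot s`_i s`_i.
  rewrite uE dotC dot_suml (bigD1 i) //= big1 => [|j ji].
    by rewrite addr0 dotZl.
  rewrite dotZl sO ?mulr0 //.
  by rewrite nth_uniq ?(free_uniq fs).
have DE : c *: u - T u = \sum_(i < size s) (k i * (c - ev s`_i)) *: s`_i.
  rewrite [in LHS]uE (linear_sum T) scaler_sumr -sumrB; apply: eq_bigr => i _.
  by rewrite (linearZ_LR T) /= sT // !scalerA -scalerBl; congr (_ *: _); ring.
have D : c * dot u u - dot (T u) u =
    \sum_(i < size s) (k i ^+ 2 * (c - ev s`_i) * dot s`_i s`_i).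
  rewrite -dotZl -dotBl DE dot_suml; apply: eq_bigr => i _.
  by rewrite dotZl si_u; ring.
have D0 (i : 'I_(size s)) : 0 <= k i ^+ 2 * (c - ev s`_i) * dot s`_i s`_i.
  apply: mulr_ge0 (dot_ge0 _); apply: mulr_ge0 (sqr_ge0 _) _.
  by rewrite subr_ge0; exact: sc.
split; first by rewrite -subr_ge0 D sumr_ge0.
rewrite eq_sym -subr_eq0 D; apply/eqP/eqP => [E|Tu]; last first.
  by rewrite -D Tu dotZl subrr.
apply/esym/eqP; rewrite -subr_eq0 DE big1 // => i _; apply/eqP.
have /eqP : k i ^+ 2 * (c - ev s`_i) * dot s`_i s`_i = 0.
  by apply: (psumr_eq0P (fun i _ => D0 i)) E _ _.
by rewrite !mulf_eq0 orbb dot_eq0 scaler_eq0 mulf_eq0.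
Qed.

Lemma rayleigh_span_ge T s (ev : U -> R) c u :
  free s -> pairwise_orthogonal s ->
  {in s, forall v, T v = ev v *: v} -> {in s, forall v, c <= ev v} ->
  u \in <<s>>%VS -> c * dot u u <= dot (T u) u ?= iff (T u == c *: u).
Proof.
move=> fs sO sT sc us.
(* Negating the operator and its eigenvalues reverses the bound. *)
have [||le eq] := @rayleigh_span_le (- T) s (\- ev) (- c) u fs sO _ _ us.
- by move=> v vs; rewrite opp_lfunE sT // scaleNr.
- by move=> v vs; rewrite lerN2 sc.
move: le eq; rewrite opp_lfunE -scaleN1r dotZl !mulN1r mulNr scaleN1r scaleNr.
by rewrite lerN2 !eqr_opp eq_sym => le eq; split.
Qed.

Lemma size_basis_full b : basis_of {:U} b -> size b = \dim {:U}.
Proof. by move=> bb; rewrite -(eqnP (basis_free bb)) (span_basis bb). Qed.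

Lemma sorted_eigenvalues T : sorted <=%R (eigenvalues T).
Proof. by apply: sorted_flatten_nseq; exact: sorted_roots. Qed.

(** * Spectral subspaces and Weyl's inequalities *)

Lemma eigenspace_below T k : self_adjoint T -> (1 <= k <= \dim {:U})%N ->
  exists2 W, \dim W = k & {in W, forall u,
    dot (T u) u <= eigenvalue_nth T k * dot u u
      ?= iff (T u == eigenvalue_nth T k *: u)}.
Proof.
move=> Tsa /andP[k0 kn]; have [b [bb bO bT bE]] := spectral_basis Tsa.
have sb := size_basis_full bb.
have sub : {subset take k b <= b} by move=> x; exact: mem_take.
have fr : free (take k b).
  by have := basis_free bb; rewrite -{1}(cat_take_drop k b) => /catl_free.
(* Taking exactly [k] vectors of the sorted eigenbasis, whatever the multiplicities, keeps the
   dimension equal to [k]. *)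
exists <<take k b>>%VS => [|u].
  by rewrite (eqnP fr) size_takel // sb.
apply: (@rayleigh_span_le _ _ (rayleigh T)) => //; try exact: sub_in1 bT.
  exact: sub_in2 bO.
move=> v /(nthP 0)[j]; rewrite size_takel ?sb // => jk <-; rewrite nth_take //.
have jn := leq_trans jk kn.
rewrite -(nth_map 0 0 (rayleigh T)) ?sb // /eigenvalue_nth -bE.
apply: (sorted_leq_nth le_trans le_refl) (sorted_eigenvalues T) _ _ _ _ _;
  rewrite ?inE ?bE ?size_map ?sb; lia.
Qed.

Lemma eigenspace_above T k : self_adjoint T -> (1 <= k <= \dim {:U})%N ->
  exists2 W, (\dim W + k = (\dim {:U}).+1)%N & {in W, forall u,
    eigenvalue_nth T k * dot u u <= dot (T u) u
      ?= iff (T u == eigenvalue_nth T k *: u)}.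
Proof.
move=> Tsa /andP[k0 kn]; have [b [bb bO bT bE]] := spectral_basis Tsa.
have sb := size_basis_full bb.
have sub : {subset drop k.-1 b <= b} by move=> x; exact: mem_drop.
have fr : free (drop k.-1 b).
  by have := basis_free bb; rewrite -{1}(cat_take_drop k.-1 b) => /catr_free.
(* Only [k.-1] vectors are dropped: the [k]-th one stays, so the dimension is
   [\dim {:U} - k + 1]. *)
exists <<drop k.-1 b>>%VS => [|u].
  by rewrite (eqnP fr) size_drop sb; lia.
apply: (@rayleigh_span_ge _ _ (rayleigh T)) => //; try exact: sub_in1 bT.
  exact: sub_in2 bO.
move=> v /(nthP 0)[j]; rewrite size_drop ?sb // => jk <-; rewrite nth_drop //.
rewrite -(nth_map 0 0 (rayleigh T)) ?sb; last lia.
rewrite /eigenvalue_nth -bE.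
apply: (sorted_leq_nth le_trans le_refl) (sorted_eigenvalues T) _ _ _ _ _;
  rewrite ?inE ?bE ?size_map ?sb; lia.
Qed.

(** The hypothesis says that the three codimensions add up to less than the full dimension; the
    formula for the dimension of a sum, used twice, leaves a nonzero intersection. *)
Lemma common_vector W1 W2 W3 :
  ((\dim {:U}).*2 < \dim W1 + \dim W2 + \dim W3)%N ->
  exists u, [/\ u != 0, u \in W1, u \in W2 & u \in W3].
Proof.
move=> dW; pose W := (W1 :&: (W2 :&: W3))%VS.
have W0 : W != 0%VS.
  rewrite -dimv_eq0.
  have := dimv_sum_cap W1 (W2 :&: W3); have := dimv_sum_cap W2 W3.
  have := dimvS (subvf (W1 + (W2 :&: W3))); have := dimvS (subvf (W2 + W3)).
  rewrite -/W; lia.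
exists (vpick W); rewrite vpick0; have := memv_pick W.
by rewrite !memv_cap => /andP[-> /andP[-> ->]].
Qed.

Lemma eigenvector_sum T T1 T2 (a a1 a2 : R) u : (forall v, T v = T1 v + T2 v) ->
  u != 0 -> T u = a *: u -> T1 u = a1 *: u -> T2 u = a2 *: u -> a = a1 + a2.
Proof.
move=> TE u0 Tu T1u T2u; apply/eqP; rewrite -subr_eq0.
have /eqP : (a - (a1 + a2)) *: u = 0.
  by rewrite scalerBl scalerDl -Tu -T1u -T2u TE subrr.
by rewrite scaler_eq0 (negPf u0) orbF.
Qed.

Lemma weyl_upper T T1 T2 i p q : self_adjoint T1 -> self_adjoint T2 ->
  (forall u, T u = T1 u + T2 u) ->
  (1 <= i)%N -> (1 <= p <= \dim {:U})%N -> (1 <= q <= \dim {:U})%N ->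
  (p + q = i + \dim {:U})%N ->
  eigenvalue_nth T i <= eigenvalue_nth T1 p + eigenvalue_nth T2 q /\
  (eigenvalue_nth T i = eigenvalue_nth T1 p + eigenvalue_nth T2 q <->
   exists u, [/\ u != 0, T u = eigenvalue_nth T i *: u,
     T1 u = eigenvalue_nth T1 p *: u & T2 u = eigenvalue_nth T2 q *: u]).
Proof.
move=> sa1 sa2 TE i1 pn qn pq.
have sa : self_adjoint T.
  by move=> u v; rewrite !TE dotDl dotDr sa1 sa2.
have iN : (1 <= i <= \dim {:U})%N by lia.
have [W dW HW] := eigenspace_above sa iN.
have [W1 dW1 HW1] := eigenspace_below sa1 pn.
have [W2 dW2 HW2] := eigenspace_below sa2 qn.
(* With [n] the full dimension, the dimensions are [n + 1 - i], [p] and [q], with sum [2n + 1] since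
   [p + q = i + n]. *)
have [|u [u0 uW uW1 uW2]] := @common_vector W W1 W2; first lia.
have uu := dot_gt0 u0.
have := leifD (HW1 u uW1) (HW2 u uW2).
(* Chaining with [leif] keeps the equality conditions: the chain is an equality exactly when all
   three eigenvector equations hold at [u]. *)
rewrite -dotDl -TE -mulrDl => /(leif_trans (HW u uW))[].
rewrite ler_pM2r // => le eq; split=> //.
split=> [E|[v [v0 Tv T1v T2v]]]; last exact: (eigenvector_sum TE v0) Tv T1v T2v.
move: eq; rewrite E eqxx => /esym/and3P[/eqP Tu /eqP T1u /eqP T2u].
by exists u.
Qed.

Lemma weyl_lower T T1 T2 i p q : self_adjoint T1 -> self_adjoint T2 ->
  (forall u, T u = T1 u + T2 u) ->
  (1 <= p)%N -> (1 <= q)%N -> (i <= \dim {:U})%N -> (p + q = i.+1)%N ->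
  eigenvalue_nth T1 p + eigenvalue_nth T2 q <= eigenvalue_nth T i /\
  (eigenvalue_nth T i = eigenvalue_nth T1 p + eigenvalue_nth T2 q <->
   exists u, [/\ u != 0, T u = eigenvalue_nth T i *: u,
     T1 u = eigenvalue_nth T1 p *: u & T2 u = eigenvalue_nth T2 q *: u]).
Proof.
move=> sa1 sa2 TE p1 q1 iN pq.
have sa : self_adjoint T.
  by move=> u v; rewrite !TE dotDl dotDr sa1 sa2.
have [|W dW HW] := eigenspace_below (k := i) sa; first lia.
have [|W1 dW1 HW1] := eigenspace_above (k := p) sa1; first lia.
have [|W2 dW2 HW2] := eigenspace_above (k := q) sa2; first lia.
(* Now the dimensions are [i], [n + 1 - p] and [n + 1 - q], again with sum [2n + 1] since
   [p + q = i + 1]. *)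
have [|u [u0 uW uW1 uW2]] := @common_vector W W1 W2; first lia.
have uu := dot_gt0 u0.
have := leifD (HW1 u uW1) (HW2 u uW2).
rewrite -dotDl -TE -mulrDl => /leif_trans/(_ (HW u uW))[].
rewrite ler_pM2r // => le eq; split=> //.
split=> [E|[v [v0 Tv T1v T2v]]]; last exact: (eigenvector_sum TE v0) Tv T1v T2v.
move: eq; rewrite E eqxx => /esym/andP[/andP[/eqP T1u /eqP T2u] /eqP Tu].
by exists u.
Qed.

End Spectral.

(** * Mass-weighted inner products and adjointness of the graph operators *)

Section Graph.
Variables (R : rcfType) (V : finType) (G : wgraph R V).
Implicit Types S B : {set V}.

Definition mass_dot S (u v : fspace R S) : R :=
  \sum_x mass G (val x) * (u x * v x).

Lemma mass_dot_linear S (w : fspace R S) : linear_for *%R (@mass_dot S ^~ w).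
Proof.
move=> a u v; rewrite /mass_dot mulr_sumr -big_split; apply: eq_bigr => x _ /=.
by rewrite !ffunE /GRing.scale /=; ring.
Qed.

Lemma mass_dotC S (u v : fspace R S) : mass_dot u v = mass_dot v u.
Proof. by apply: eq_bigr => x _; rewrite (mulrC (u x)). Qed.

Lemma mass_dot_gt0 S (u : fspace R S) : u != 0 -> 0 < mass_dot u u.
Proof.
move=> u0; have [x ux0] : exists x, u x != 0.
  apply/existsP; apply: contraNT u0 => /existsPn u0; apply/eqP/ffunP => x.
  by rewrite ffunE; have /negbNE/eqP := u0 x.
have ge0 y : 0 <= mass G (val y) * (u y * u y).
  by rewrite -expr2 mulr_ge0 ?sqr_ge0 ?ltW ?mass_gt0.
rewrite /mass_dot (bigD1 x) //=; apply: ltr_wpDr.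
  by apply: sumr_ge0 => y _; exact: ge0.
apply: mulr_gt0 (mass_gt0 _ _) _.
by rewrite lt_def mulf_eq0 orbb ux0 -expr2 sqr_ge0.
Qed.

Lemma ext0_val S (u : fspace R S) x : ext0 u (val x) = u x.
Proof. by rewrite ffunE valK. Qed.

Lemma ext0_notin S (u : fspace R S) x : x \notin S -> ext0 u x = 0.
Proof. by move=> xS; rewrite ffunE insubN. Qed.

Lemma sum_ext0 S (u : fspace R S) (F : V -> R) :
  \sum_x F (val x) * u x = \sum_x F x * ext0 u x.
Proof.
transitivity (\sum_(x in S) F x * ext0 u x).
  by rewrite [RHS]big_sub; apply: eq_bigr => x _; rewrite ext0_val.
rewrite big_mkcond; apply: eq_bigr => x _.
by case: ifPn => // /ext0_notin ->; rewrite mulr0.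
Qed.

Lemma laplacian_self_adjoint (u v : {ffun V -> R^o}) :
  \sum_x mass G x * (laplacian G u x * v x) =
  \sum_x mass G x * (u x * laplacian G v x).
Proof.
(* The mass cancels. The first double sum is symmetric in [f] and [g] termwise, the second after
   exchanging [x] and [y]. *)
have E (f g : {ffun V -> R^o}) : \sum_x mass G x * (laplacian G f x * g x) =
    \sum_x \sum_y f x * g x * weight G x y -
    \sum_x \sum_y f y * g x * weight G x y.
  rewrite -sumrB; apply: eq_bigr => x _.
  rewrite ffunE -mulrA mulVKf ?gt_eqF ?mass_gt0 // mulr_suml -sumrB.
  by apply: eq_bigr => y _; ring.
under [RHS]eq_bigr do rewrite (mulrC (u _)).
rewrite !E; congr (_ - _); last rewrite [RHS]exchange_big.
  by apply: eq_bigr => x _; apply: eq_bigr => y _; rewrite (mulrC (u x)).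
apply: eq_bigr => x _; apply: eq_bigr => y _.
by rewrite (mulrC (u y)) weight_sym.
Qed.

(** Since [ext0 v] vanishes off [S], the pairing over [S] equals one over all vertices, where
    [laplacian_self_adjoint] applies. *)
Lemma dirichlet_self_adjoint S (u v : fspace R S) :
  mass_dot (dirichlet_laplacian G u) v = mass_dot u (dirichlet_laplacian G v).
Proof.
have E (f g : fspace R S) : mass_dot (dirichlet_laplacian G f) g =
    \sum_x mass G x * (laplacian G (ext0 f) x * ext0 g x).
  under [RHS]eq_bigr do rewrite mulrA.
  by rewrite -sum_ext0; apply: eq_bigr => x _; rewrite ffunE mulrA.
rewrite E laplacian_self_adjoint mass_dotC E.
by apply: eq_bigr => x _; rewrite (mulrC (ext0 u x)).
Qed.

Lemma adjacency_adjoint S S' (u : fspace R S) (v : fspace R S') :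
  mass_dot (adjacency G S' u) v = mass_dot u (adjacency G S v).
Proof.
have E S1 S2 (f : fspace R S1) (g : fspace R S2) :
    mass_dot (adjacency G S2 f) g =
    \sum_x \sum_y f y * g x * weight G (val x) (val y).
  apply: eq_bigr => x _.
  rewrite ffunE -mulrA mulVKf ?gt_eqF ?mass_gt0 // mulr_suml.
  by apply: eq_bigr => y _; rewrite mulrAC.
rewrite E mass_dotC E exchange_big; apply: eq_bigr => x _.
by apply: eq_bigr => y _; rewrite (mulrC (u x)) weight_sym.
Qed.

(** At a vertex of [S'] the extension is zero, so only the neighbour terms of the Laplacian survive,
    with a minus sign. *)
Lemma restrict_laplacian_ext0 S S' (u : fspace R S) : [disjoint S' & S] ->
  restrict S' (laplacian G (ext0 u)) = - adjacency G S' u.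
Proof.
move=> dis; apply/ffunP => x; rewrite !ffunE -mulrN -sumrN; congr (_ * _).
have xS : val x \notin S by rewrite (disjointFr dis) ?(valP x).
under [RHS]eq_bigr do rewrite mulrC.
rewrite [in RHS]sumrN sum_ext0 -sumrN; apply: eq_bigr => y _.
by rewrite insubN // sub0r mulNr mulrC.
Qed.

Lemma restrict_ext0 S (u : fspace R S) : restrict S (ext0 u) = u.
Proof. by apply/ffunP => x; rewrite ffunE ext0_val. Qed.

Lemma dim_fspace S : \dim {:fspace R S} = #|S|.
Proof. by rewrite dimvf /dim /= card_sig muln1; apply: eq_card. Qed.

(** * Decomposition of the Dirichlet Laplacian *)

Section Boundary.
Variable B : {set V}.
Hypothesis BG : component_meets_interior G B.

Let L := linfun (@dirichlet_laplacian R V G B).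

Lemma boundary_laplacianK (f : fspace R B) :
  dirichlet_laplacian G ((L^-1)%VF f) = f.
Proof.
rewrite -[LHS]lfunE; apply: lker0_lfunVK.
apply/lker0P => u v; rewrite !lfunE; exact: dirichlet_laplacian_inj.
Qed.

(** By uniqueness it suffices that the right-hand side is harmonic on [B]: there the two Laplacians
    are minus and plus [adjacency G B u]. *)
Lemma harmonic_ext_boundary (u : fspace R (~: B)) :
  harmonic_ext G u = ext0 u + ext0 ((L^-1)%VF (adjacency G B u)).
Proof.
apply: (harmonic_ext_unique BG (harmonic_extP BG u)).
set f := (L^-1)%VF _; split=> [|x xB].
  rewrite linearD /= restrict_ext0 [X in _ + X](_ : _ = 0) ?addr0 //.
  apply/ffunP => x; rewrite !ffunE insubN //.
  by have := valP x; rewrite inE.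
have : restrict B (laplacian G (ext0 u + ext0 f)) = 0.
  rewrite linearD /= linearD /= restrict_laplacian_ext0.
    by rewrite [X in _ + X]boundary_laplacianK addNr.
  by rewrite -setI_eq0 setICr.
by move=> /ffunP/(_ (Sub x xB)); rewrite !ffunE.
Qed.

Lemma neumann_laplacianE (u : fspace R (~: B)) :
  neumann_laplacian G u = dirichlet_laplacian G u - AdjLinvAdj G B u.
Proof.
rewrite /neumann_laplacian harmonic_ext_boundary !linearD /=; congr (_ + _).
rewrite restrict_laplacian_ext0; last by rewrite -setI_eq0 setIC setICr.
by rewrite /AdjLinvAdj !comp_lfunE !lfunE.
Qed.

Lemma DirichletLE (u : fspace R (~: B)) :
  DirichletL G B u = dirichlet_laplacian G u.
Proof. exact: lfunE. Qed.

Lemma NeumannLE (u : fspace R (~: B)) : NeumannL G B u = neumann_laplacian G u.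
Proof.
(* Linearity here depends on [BG], so the linear structure is built locally before [lfunE] can
   apply. *)
pose NL := GRing.isLinear.Build R _ _ _ (@neumann_laplacian R V G B)
  (neumann_laplacian_is_linear BG).
pose N : {linear fspace R (~: B) -> fspace R (~: B)} :=
  HB.pack (@neumann_laplacian R V G B) NL.
exact: (lfunE N).
Qed.

(** The outer factors are adjoint to each other, and the inverse between them inherits
    self-adjointness from the Dirichlet Laplacian on [B]. *)
Lemma AdjLinvAdj_self_adjoint :
  self_adjoint (@mass_dot (~: B)) (AdjLinvAdj G B).
Proof.
have K_sa (f g : fspace R B) :
    mass_dot ((L^-1)%VF f) g = mass_dot f ((L^-1)%VF g).
  rewrite -{1}(boundary_laplacianK g) -dirichlet_self_adjoint.
  by rewrite boundary_laplacianK.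
move=> u v; rewrite /AdjLinvAdj !comp_lfunE !lfunE /=.
by rewrite adjacency_adjoint K_sa -adjacency_adjoint.
Qed.

Lemma NeumannL_self_adjoint : self_adjoint (@mass_dot (~: B)) (NeumannL G B).
Proof.
move=> u v; rewrite !NeumannLE !neumann_laplacianE.
rewrite (dotBl (@mass_dot_linear _)) AdjLinvAdj_self_adjoint.
rewrite dirichlet_self_adjoint ![mass_dot u _]mass_dotC.
by rewrite (dotBl (@mass_dot_linear _)).
Qed.

End Boundary.
End Graph.

Theorem theorem5p1 (R : rcfType) (V : finType) (G : wgraph R V) (B : {set V}) :
  B != set0 -> component_meets_interior G B ->
  let n := #|~: B| in
  let lambda := eigenvalue_nth (DirichletL G B) in
  let nu := eigenvalue_nth (NeumannL G B) in
  let alpha := eigenvalue_nth (AdjLinvAdj G B) in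
  (forall i j : nat, (1 <= i <= n)%N -> (j <= n - i)%N ->
     lambda i <= nu (i + j)%N + alpha (n - j)%N /\
     (lambda i = nu (i + j)%N + alpha (n - j)%N <->
      exists u : fspace R (~: B),
        [/\ u != 0,
            dirichlet_laplacian G u = lambda i *: u,
            neumann_laplacian G u = nu (i + j)%N *: u
          & AdjLinvAdj G B u = alpha (n - j)%N *: u])) /\
  (forall i j : nat, (1 <= i <= n)%N -> (1 <= j <= i)%N ->
     nu (i - j + 1)%N + alpha j <= lambda i /\
     (lambda i = nu (i - j + 1)%N + alpha j <->
      exists u : fspace R (~: B),
        [/\ u != 0,
            dirichlet_laplacian G u = lambda i *: u,
            neumann_laplacian G u = nu (i - j + 1)%N *: u
          & AdjLinvAdj G B u = alpha j *: u])).
Proof.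
move=> _ BG n lambda nu alpha.
have TE u : DirichletL G B u = NeumannL G B u + AdjLinvAdj G B u.
  by rewrite DirichletLE NeumannLE // neumann_laplacianE // subrK.
have dimE : \dim {:fspace R (~: B)} = n by exact: dim_fspace.
(* Weyl's inequalities concern the bundled linear maps, the theorem the underlying functions. *)
have convert a b c :
    (exists u, [/\ u != 0, DirichletL G B u = a *: u,
       NeumannL G B u = b *: u & AdjLinvAdj G B u = c *: u]) <->
    (exists u : fspace R (~: B), [/\ u != 0, dirichlet_laplacian G u = a *: u,
       neumann_laplacian G u = b *: u & AdjLinvAdj G B u = c *: u]).
  by split=> -[u [u0 Du Nu Au]]; exists u; split=> //;
    rewrite -?DirichletLE -?NeumannLE // ?DirichletLE ?NeumannLE.
have weyl_le := weyl_upper (@mass_dot_linear _ _ G _) (@mass_dotC _ _ G _)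
  (@mass_dot_gt0 _ _ G _) (NeumannL_self_adjoint BG)
  (AdjLinvAdj_self_adjoint BG) TE.
have weyl_ge := weyl_lower (@mass_dot_linear _ _ G _) (@mass_dotC _ _ G _)
  (@mass_dot_gt0 _ _ G _) (NeumannL_self_adjoint BG)
  (AdjLinvAdj_self_adjoint BG) TE.
rewrite dimE in weyl_le weyl_ge.
split=> i j /andP[i1 iN] jn.
  (* The indices add up to [i + n], as the upper bound demands. *)
  have [||||le eq] := weyl_le i (i + j)%N (n - j)%N; try lia.
  by split=> //; rewrite -convert.
(* The indices add up to [i + 1], as the lower bound demands. *)
have [||||le eq] := weyl_ge i (i - j + 1)%N j; try lia.
by split=> //; rewrite -convert.
Qed.
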